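(* Let $0<q<1$. Consider couples of random vectors $(U,V)\in\mathbb{R}^d\times\mathbb{R}^d$, both centered ($\mathbb{E}U=\mathbb{E}V=0$) and normalized ($\mathbb{E}|U|^2=\mathbb{E}|V|^2=1$), with $U\sim\mathcal{N}(0,\frac1d\mathrm{Id})$, and let $(U_\ast,V_\ast)$ be an i.i.d. copy of $(U,V)$. Denote $m_q=\mathbb{E}(|V|^q)^{1/q}$. Then $$\lim_{m_q\to0}\mathbb{E}\Big(|U-U_\ast||V-V_\ast|-(U-U_\ast)\cdot(V-V_\ast)\Big)=0.$$
   Context: The limit $m_q\to0$ means: for every $\epsilon>0$ there is $\delta>0$ such that for every such couple $(U,V)$ with $m_q<\delta$, the expectation is less than $\epsilon$ ($q$ and $d$ being fixed). *)

(* Defs.v *)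
From mathcomp Require Import all_boot all_order all_algebra.
From mathcomp Require Import all_classical all_reals all_analysis.

Set Implicit Arguments.
Unset Strict Implicit.
Unset Printing Implicit Defensive.

Import Order.TTheory GRing.Theory Num.Theory.

Local Open Scope classical_set_scope.
Local Open Scope ring_scope.

(* R^d is the type d.-tuple R, on which the library puts the product of the
   Borel sigma-algebras; being a plain tuple type it carries no vector space
   structure, hence the operations below. *)

Definition vsub (R : realType) (d : nat) (x y : d.-tuple R) : d.-tuple R :=
  [tuple tnth x i - tnth y i | i < d].

Definition vdot (R : realType) (d : nat) (x y : d.-tuple R) : R :=
  \sum_(i < d) tnth x i * tnth y i.

(* The Euclidean norm (the library norm on vectors is the sup norm). *)
Definition vnorm (R : realType) (d : nat) (x : d.-tuple R) : R :=
  Num.sqrt (vdot x x).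

Definition centered (R : realType) (d : nat) (disp : measure_display)
    (T : measurableType disp) (P : probability T R)
    (X : {RV P >-> d.-tuple R}) : Prop :=
  forall i : 'I_d, ('E_P[fun w => tnth (X w) i] = 0)%E.

(* X ~ N(0, s^2 Id): the law of X is the d-fold product of N(0, s^2), i.e. its
   coordinates are independent and N(0, s^2)-distributed.  Like that of
   normal_prob, the parameter s is the standard deviation. *)
Definition isotropic_gaussian (R : realType) (d : nat)
    (disp : measure_display) (T : measurableType disp) (P : probability T R)
    (s : R) (X : {RV P >-> d.-tuple R}) : Prop :=
  forall A : 'I_d -> set R, (forall i, measurable (A i)) ->
    P [set w | forall i, A i (tnth (X w) i)] =
    (\prod_(i < d) normal_prob 0 s (A i))%E.

(* Laws are compared on measurable sets only: pushforward P X and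
   pushforward P Y are functions defined on all subsets. *)
Definition same_law (R : realType) (disp disp' : measure_display)
    (T : measurableType disp) (T' : measurableType disp')
    (P : probability T R) (X Y : T -> T') : Prop :=
  forall A : set T', measurable A -> pushforward P X A = pushforward P Y A.

Definition independent (R : realType) (disp disp' : measure_display)
    (T : measurableType disp) (T' : measurableType disp')
    (P : probability T R) (X Y : T -> T') : Prop :=
  forall A B : set T', measurable A -> measurable B ->
    P (X @^-1` A `&` Y @^-1` B) = (P (X @^-1` A) * P (Y @^-1` B))%E.

Definition iid_copy (R : realType) (disp disp' : measure_display)
    (T : measurableType disp) (T' : measurableType disp')
    (P : probability T R) (X Y : T -> T') : Prop :=
  same_law P X Y /\ independent P X Y.

Definition moment_norm (R : realType) (d : nat) (disp : measure_display)
    (T : measurableType disp) (P : probability T R) (q : R)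
    (X : {RV P >-> d.-tuple R}) : \bar R :=
  ('E_P[fun w => (vnorm (X w) `^ q)%R] `^ q^-1)%E.

Arguments centered {R d disp T} P X.
Arguments isotropic_gaussian {R d disp T} P s X.
Arguments moment_norm {R d disp T} P q X.

(* Main.v *)
Require Import Defs.
From mathcomp Require Import all_boot all_order all_algebra.
From mathcomp Require Import all_classical all_reals all_analysis.
From mathcomp Require Import measurable_realfun ring lra.

Set Implicit Arguments.
Unset Strict Implicit.
Unset Printing Implicit Defensive.

Import Order.TTheory GRing.Theory Num.Theory.
Local Open Scope classical_set_scope.
Local Open Scope ring_scope.

(** A second moment carried by rare large values leaves no first moment: if
    E|V|^q is small and E|V|^2 = 1 then V is small in L^1, by interpolation
    between L^q and L^2.  Pairing V with the Gaussian U costs nothing more,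
    because |U|^2 is uniformly integrable: U has a finite fourth moment, which
    depends on d only.  Hence E|U||V| tends to 0, and so do the three other
    products that appear when |U - U'||V - V'| is expanded.  The two terms of
    the expectation thus vanish separately, with no cancellation between them.

    Interpolation and truncation are both contained in one scalar inequality,
    [young_truncation]: for every e > 0 some A satisfies
    x v <= A v^q + e v^2 + e x^4 for all x, v >= 0.  Applied to the coordinates
    of U and to |V|, it dominates the absolute value of the integrand by
    4 d (G(U, V) + G(U', V')), where G is [cost_bound]
    ([normr_defect_le_cost_bound]).  Both summands have the same expectation,
    computed in [integral_cost_bound]: d A E|V|^q + d e (1 + M), where M is the
    fourth moment of N(0, 1/d), finite by [normal_fourth_moment_lty].  One
    chooses e, hence A, and only then delta. *)

(** * Pointwise domination of the integrand *)

(** The product is cut at x = K.  Where x is large, x v <= 2 e x^2 v and AM-GM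
    applies to v and x^2.  Where x is small, x v <= K v, and v is controlled by
    v^2 when it is large and by v^q when it is small, since v^(1 - q) is then
    bounded. *)
Lemma young_truncation (R : realType) (q e : R) : q <= 1 -> 0 < e ->
  exists A : R, 0 < A /\ forall x v : R, 0 <= x -> 0 <= v ->
    x * v <= A * v `^ q + e * v ^+ 2 + e * x ^+ 4.
Proof.
move=> q1 e0; pose K := (2 * e)^-1.
have K0 : 0 < K by rewrite invr_gt0 mulr_gt0.
have Ke : K * e = 1 / 2 by rewrite /K; field; rewrite gt_eqF.
have L0 : 0 < K / e by rewrite divr_gt0.
exists (K * (K / e) `^ (1 - q)); split; first by rewrite mulr_gt0 ?powR_gt0.
move=> x v x0 v0.
have vq0 : 0 <= K * (K / e) `^ (1 - q) * v `^ q.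
  by rewrite !mulr_ge0 ?powR_ge0// ltW.
have ev0 : 0 <= e * v ^+ 2 by rewrite mulr_ge0 ?sqr_ge0 ?ltW.
have ex0 : 0 <= e * x ^+ 4 by rewrite mulr_ge0 ?exprn_even_ge0 ?ltW.
have [Kx|xK] := leP K x.
  suff : x * v <= e * v ^+ 2 + e * x ^+ 4 by lra.
  have ex : 1 / 2 <= e * x by rewrite -Ke mulrC ler_pM2l.
  have : x * v <= 2 * e * x ^+ 2 * v.
    rewrite -subr_ge0.
    have -> : 2 * e * x ^+ 2 * v - x * v = 2 * (e * x - 1 / 2) * (x * v).
      by field.
    by rewrite !mulr_ge0// subr_ge0.
  have : 0 <= e * (v - x ^+ 2) ^+ 2 by rewrite mulr_ge0 ?sqr_ge0 ?ltW.
  lra.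
have xvK : x * v <= K * v by rewrite ler_wpM2r// ltW.
have [Lv|vL] := leP (K / e) v.
  suff : K * v <= e * v ^+ 2 by lra.
  have : K <= e * v by rewrite mulrC -ler_pdivrMr.
  by move=> /(ler_wpM2r v0); lra.
suff : K * v <= K * (K / e) `^ (1 - q) * v `^ q by lra.
rewrite -mulrA ler_pM2l//.
have [->|vn0] := eqVneq v 0; first by rewrite mulr_ge0 ?powR_ge0.
rewrite -[leLHS]powRr1// -[in leLHS](subrK q 1) powRD; last first.
  by rewrite vn0 implybT.
by rewrite ler_wpM2r ?powR_ge0// ge0_ler_powR ?subr_ge0// ?nnegrE ltW.
Qed.

Lemma vdotxx_ge0 (R : realType) (d : nat) (x : d.-tuple R) :
  0 <= vdot x x.
Proof. by apply: sumr_ge0 => i _; rewrite -expr2 sqr_ge0. Qed.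

Lemma vnorm_ge0 (R : realType) (d : nat) (x : d.-tuple R) :
  0 <= vnorm x.
Proof. exact: sqrtr_ge0. Qed.

Lemma normr_tnth_le_vnorm (R : realType) (d : nat)
    (x : d.-tuple R) (i : 'I_d) :
  `|tnth x i| <= vnorm x.
Proof.
rewrite -sqrtr_sqr ler_sqrt ?vdotxx_ge0// /vdot (bigD1 i)//= -expr2 lerDl.
by apply: sumr_ge0 => j _; rewrite -expr2 sqr_ge0.
Qed.

Lemma vnorm_le_sum (R : realType) (d : nat) (x : d.-tuple R) :
  vnorm x <= \sum_(i < d) `|tnth x i|.
Proof.
have S0 : 0 <= \sum_(i < d) `|tnth x i| by exact: sumr_ge0.
rewrite -(ger0_norm S0) -sqrtr_sqr ler_sqrt ?sqr_ge0// expr2 mulr_suml /vdot.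
apply: ler_sum => i _; rewrite (le_trans (ler_norm _))// normrM ler_wpM2l//.
by rewrite (bigD1 i)//= lerDl sumr_ge0.
Qed.

(** The factor d comes from passing through the sum of the coordinates; a bound
    with any constant depending on d is enough below. *)
Lemma vnorm_vsub_le (R : realType) (d : nat) (x y : d.-tuple R) :
  vnorm (vsub x y) <= d%:R * (vnorm x + vnorm y).
Proof.
apply: (le_trans (vnorm_le_sum _)).
rewrite mulr_natl -[X in _ *+ X]card_ord -sumr_const; apply: ler_sum => i _.
by rewrite tnth_mktuple (le_trans (ler_normB _ _))// lerD ?normr_tnth_le_vnorm.
Qed.

(** The first vector enters through the sum of its coordinates, so that only the
    one-dimensional marginals of U are needed afterwards. *)
Lemma normr_defect_le (R : realType) (d : nat) (x y : d.-tuple R) :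
  `|vnorm x * vnorm y - vdot x y| <= 2 * (\sum_(i < d) `|tnth x i|) * vnorm y.
Proof.
apply: (le_trans (ler_normB _ _)).
have dot_le : `|vdot x y| <= (\sum_(i < d) `|tnth x i|) * vnorm y.
  rewrite (le_trans (ler_norm_sum _ _ _))// mulr_suml.
  apply: ler_sum => i _; rewrite normrM ler_wpM2l//.
  exact: normr_tnth_le_vnorm.
have : `|vnorm x * vnorm y| <= (\sum_(i < d) `|tnth x i|) * vnorm y.
  rewrite ger0_norm ?mulr_ge0 ?vnorm_ge0// ler_wpM2r ?vnorm_ge0//.
  exact: vnorm_le_sum.
lra.
Qed.

(** With p = (u, v), this is the sum over the d coordinates x of u of the right
    hand side of [young_truncation] at (|x|, |v|). *)
Definition cost_bound (R : realType) (d : nat) (q A e : R)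
    (p : d.-tuple R * d.-tuple R) : R :=
  (A *+ d) * vnorm p.2 `^ q +
  ((e *+ d) * vnorm p.2 ^+ 2 + e * \sum_(i < d) tnth p.1 i ^+ 4).

(** Expanding (|u| + |u'|) (|v| + |v'|) gives mixed products such as |u| |v'|.
    They cost no more than the others because [cost_bound] is a function of u
    plus a function of v. *)
Lemma normr_defect_le_cost_bound (R : realType) (d : nat) (q A e : R) :
    (forall x v : R, 0 <= x -> 0 <= v ->
      x * v <= A * v `^ q + e * v ^+ 2 + e * x ^+ 4) ->
  forall u v u' v' : d.-tuple R,
  `|vnorm (vsub u u') * vnorm (vsub v v') - vdot (vsub u u') (vsub v v')| <=
  d%:R * 4 * (cost_bound q A e (u, v) + cost_bound q A e (u', v')).
Proof.
move=> young u v u' v'.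
have prod_le (x y : d.-tuple R) :
    (\sum_(i < d) `|tnth x i|) * vnorm y <= cost_bound q A e (x, y).
  rewrite /cost_bound/= mulr_suml mulr_sumr addrA !mulrnAl -mulrnDl.
  rewrite -[X in _ *+ X]card_ord -sumr_const -big_split/=.
  apply: ler_sum => i _.
  have := young `|tnth x i| (vnorm y) (normr_ge0 _) (vnorm_ge0 y).
  by rewrite -normrX (@ger0_norm _ (_ ^+ 4)) ?exprn_even_ge0.
apply: (le_trans (normr_defect_le _ _)).
set S := \sum_(i < d) `|tnth u i|; set S' := \sum_(i < d) `|tnth u' i|.
have Ssub : \sum_(i < d) `|tnth (vsub u u') i| <= S + S'.
  rewrite -big_split/=; apply: ler_sum => i _.
  by rewrite tnth_mktuple ler_normB.
have S0 : 0 <= \sum_(i < d) `|tnth (vsub u u') i| by exact: sumr_ge0.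
apply: (@le_trans _ _ (2 * (S + S') * (d%:R * (vnorm v + vnorm v')))).
  rewrite ler_pM ?mulr_ge0 ?vnorm_ge0 ?vnorm_vsub_le// ler_wpM2l//.
have := prod_le u v; have := prod_le u v'.
have := prod_le u' v; have := prod_le u' v'.
rewrite -/S -/S' => h1 h2 h3 h4.
have -> : 2 * (S + S') * (d%:R * (vnorm v + vnorm v')) = d%:R * (2 *
   (S' * vnorm v' + S' * vnorm v + S * vnorm v' + S * vnorm v)) by ring.
rewrite -mulrA ler_wpM2l//.
move: h1 h2 h3 h4; rewrite /cost_bound/=; lra.
Qed.

(** * Fourth moment of the normal law *)

(** A measure determines its density almost everywhere, so g may be replaced by
    the Radon-Nikodym derivative of nu, for which the change of variables
    holds. *)
Lemma ge0_integral_density (disp : measure_display) (T : measurableType disp)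
    (R : realType) (mu : {sigma_finite_measure set T -> \bar R})
    (nu : {finite_measure set T -> \bar R}) (g f : T -> \bar R) :
  mu.-integrable [set: T] g ->
  (forall A, measurable A -> nu A = \int[mu]_(x in A) g x)%E ->
  measurable_fun [set: T] f -> (forall x, 0 <= f x)%E ->
  (\int[nu]_x f x = \int[mu]_x (f x * g x))%E.
Proof.
move=> ig nuE mf f0.
have numu : nu `<< mu.
  apply/null_content_dominatesP => A mA muA0; rewrite nuE//.
  apply: null_set_integral => //.
  exact: (measurable_funS measurableT (@subsetT _ _) (measurable_int _ ig)).
have mRN := Radon_Nikodym_SigmaFinite.f_integrable numu.
rewrite -(Radon_Nikodym_SigmaFinite.change_of_variables numu)//.
apply: ae_eq_integral => //.
- by apply: emeasurable_funM => //; exact: (measurable_int _ mRN).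
- by apply: emeasurable_funM => //; exact: (measurable_int _ ig).
- apply: ae_eqe_mul2l; apply: integral_ae_eq => //.
  + exact: (measurable_int _ ig).
  + by move=> A _ mA; rewrite -Radon_Nikodym_SigmaFinite.f_integral// nuE.
Qed.

(** The density of N(0, s^2) is that of N(0, 4 s^2) times a constant multiple of
    exp (- t) with t = 3 x^2 / (8 s^2), and x^4 is a multiple of t^2, hence
    dominated by exp t.  So x^4 times the first density is at most a constant
    times the second one, whose integral is 1. *)
Lemma normal_fourth_moment_lty (R : realType) (s : R) : s != 0 ->
  (\int[normal_prob 0 s]_x (x ^+ 4)%:E < +oo)%E.
Proof.
move=> s0.
rewrite (@ge0_integral_density _ _ _ lebesgue_measure (normal_prob 0 s)
  (EFin \o normal_pdf 0 s))//; last 3 first.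
- exact: integrable_normal_pdf.
- exact/measurable_EFinP/measurable_funX.
- by move=> x; rewrite lee_fin exprn_even_ge0.
have s20 : 2 * s != 0 by rewrite mulf_neq0// pnatr_eq0.
pose C : R := (s ^+ 4 * (16 * normal_peak s / normal_peak (2 * s))).
have C0 : 0 <= C.
  apply: mulr_ge0; first exact: exprn_even_ge0.
  by rewrite divr_ge0 ?normal_peak_ge0// mulr_ge0 ?normal_peak_ge0.
have pdf_le (x : R) : x ^+ 4 * normal_pdf 0 s x <= C * normal_pdf 0 (2 * s) x.
  rewrite !normal_pdfE// /normal_fun !subr0.
  set t := 3 / 8 * x ^+ 2 / s ^+ 2.
  have t0 : 0 <= t by rewrite divr_ge0 ?sqr_ge0// mulr_ge0 ?sqr_ge0//; lra.
  have te : t ^+ 2 <= 2 * expR t.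
    have := expR_ge1Dxn 1 t0; rewrite (_ : 2`!%:R = 2 :> R)//; lra.
  have -> : - x ^+ 2 / ((2 * s) ^+ 2 *+ 2) = t + - x ^+ 2 / (s ^+ 2 *+ 2).
    by rewrite /t; field.
  have x4 : x ^+ 4 <= 16 * s ^+ 4 * expR t.
    have -> : x ^+ 4 = 64 / 9 * s ^+ 4 * t ^+ 2 by rewrite /t; field.
    apply: (@le_trans _ _ (64 / 9 * s ^+ 4 * (2 * expR t))).
      by rewrite ler_wpM2l// mulr_ge0// exprn_even_ge0.
    have : 0 <= s ^+ 4 * expR t by rewrite mulr_ge0 ?expR_ge0 ?exprn_even_ge0.
    lra.
  rewrite expRD /C.
  set E := expR (- x ^+ 2 / (s ^+ 2 *+ 2)).
  have -> : s ^+ 4 * (16 * normal_peak s / normal_peak (2 * s)) *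
     (normal_peak (2 * s) * (expR t * E)) =
     (16 * s ^+ 4 * expR t) * (normal_peak s * E).
    by field; rewrite gt_eqF// normal_peak_gt0.
  by rewrite ler_wpM2r// mulr_ge0 ?normal_peak_ge0 ?expR_ge0.
have lty : (\int[lebesgue_measure]_x
    (C%:E * (normal_pdf 0 (2 * s) x)%:E) < +oo)%E.
  rewrite ge0_integralZl_EFin//; last 2 first.
  - by move=> x _; rewrite lee_fin normal_pdf_ge0.
  - by apply/measurable_EFinP; exact: measurable_normal_pdf.
  by rewrite integral_normal_pdf mule1 ltry.
apply: le_lt_trans lty.
apply: ge0_le_integral => //.
- move=> x _; rewrite -EFinM lee_fin mulr_ge0 ?normal_pdf_ge0//.
  exact: exprn_even_ge0.
- apply: emeasurable_funM; first exact/measurable_EFinP/measurable_funX.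
  by apply/measurable_EFinP; exact: measurable_normal_pdf.
- apply: emeasurable_funM => //.
  by apply/measurable_EFinP; exact: measurable_normal_pdf.
- by move=> x _; rewrite -!EFinM lee_fin; exact: pdf_le.
Qed.

(** * Measurability and laws *)

Lemma measurable_tnth_comp (R : realType) (d : nat) (disp : measure_display)
    (T : measurableType disp) (X : T -> d.-tuple R) (i : 'I_d) :
  measurable_fun [set: T] X ->
  measurable_fun [set: T] (fun w => tnth (X w) i).
Proof. by move=> mX; apply: measurableT_comp (measurable_tnth i) mX. Qed.

Lemma measurable_vdot (R : realType) (d : nat) (disp : measure_display)
    (T : measurableType disp) (X Y : T -> d.-tuple R) :
  measurable_fun [set: T] X -> measurable_fun [set: T] Y ->
  measurable_fun [set: T] (fun w => vdot (X w) (Y w)).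
Proof.
move=> mX mY; apply: measurable_sum => i.
by apply: measurable_funM; exact: measurable_tnth_comp.
Qed.

Lemma measurable_vnorm (R : realType) (d : nat) (disp : measure_display)
    (T : measurableType disp) (X : T -> d.-tuple R) :
  measurable_fun [set: T] X ->
  measurable_fun [set: T] (fun w => vnorm (X w)).
Proof.
move=> mX; apply: measurableT_comp (measurable_vdot mX mX).
by apply: continuous_measurable_fun; exact: sqrt_continuous.
Qed.

Lemma measurable_vsub (R : realType) (d : nat) (disp : measure_display)
    (T : measurableType disp) (X Y : T -> d.-tuple R) :
  measurable_fun [set: T] X -> measurable_fun [set: T] Y ->
  measurable_fun [set: T] (fun w => vsub (X w) (Y w)).
Proof.
move=> mX mY; apply/measurable_fun_tnthP => i.
rewrite (_ : _ \o _ = fun w => tnth (X w) i - tnth (Y w) i); last first.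
  by apply/funext => w /=; rewrite tnth_mktuple.
by apply: measurable_funB; exact: measurable_tnth_comp.
Qed.

Lemma same_law_integral (disp disp' : measure_display)
    (T : measurableType disp) (T' : measurableType disp') (R : realType)
    (P : probability T R) (X Y : T -> T') (f : T' -> \bar R) :
  measurable_fun [set: T] X -> measurable_fun [set: T] Y -> same_law P X Y ->
  measurable_fun [set: T'] f -> (forall x, 0 <= f x)%E ->
  (\int[P]_w f (X w) = \int[P]_w f (Y w))%E.
Proof.
move=> mX mY XY mf f0.
rewrite -(@ge0_integral_pushforward _ _ _ _ _ _ mX P setT)//.
rewrite -(@ge0_integral_pushforward _ _ _ _ _ _ mY P setT)//.
by apply: eq_measure_integral => A mA _; exact: XY.
Qed.

(** Taking all the other factors of the box to be the whole line isolates one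
    marginal. *)
Lemma isotropic_gaussian_coord (R : realType) (d : nat) (disp : measure_display)
    (T : measurableType disp) (P : probability T R) (s : R)
    (U : {RV P >-> d.-tuple R}) (i : 'I_d) (A : set R) :
  isotropic_gaussian P s U -> measurable A ->
  pushforward P (fun w => tnth (U w) i) A = normal_prob 0 s A.
Proof.
move=> gU mA; pose B j := if j == i then A else [set: R].
have mB j : measurable (B j) by rewrite /B; case: ifP.
transitivity (P [set w | forall j, B j (tnth (U w) j)]).
  congr (P _); apply/seteqP; split => w /=; last first.
    by move=> /(_ i); rewrite /B eqxx.
  by move=> Aw j; rewrite /B; case: eqP => [->|].
rewrite gU// (bigD1 i)//= /B eqxx big1 ?mule1// => j /negPf ->.
exact: probability_setT.
Qed.

Lemma isotropic_gaussian_integral_coord (R : realType) (d : nat)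
    (disp : measure_display) (T : measurableType disp) (P : probability T R)
    (s : R) (U : {RV P >-> d.-tuple R}) (i : 'I_d) (f : R -> \bar R) :
  isotropic_gaussian P s U ->
  measurable_fun [set: R] f -> (forall x, 0 <= f x)%E ->
  (\int[P]_w f (tnth (U w) i) = \int[normal_prob 0 s]_x f x)%E.
Proof.
move=> gU mf f0.
(* [normal_prob] is a measure on measurableTypeR R: the type ascription puts the
   law of the coordinate on the same measurable space. *)
have mUi : measurable_fun [set: T]
    ((fun w => tnth (U w) i) : T -> measurableTypeR R).
  exact: measurable_tnth_comp.
rewrite -(@ge0_integral_pushforward _ _ _ _ _ _ mUi P setT)//.
by apply: eq_measure_integral => A mA _; exact: isotropic_gaussian_coord.
Qed.

(** The passage from m_q to E|V|^q also excludes that the latter is infinite,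
    since the power of +oo is +oo. *)
Lemma moment_norm_lt (R : realType) (d : nat) (disp : measure_display)
    (T : measurableType disp) (P : probability T R) (q m : R)
    (V : {RV P >-> d.-tuple R}) : 0 < q -> 0 <= m ->
  (moment_norm P q V < (m `^ q^-1)%:E)%E ->
  ('E_P[fun w => (vnorm (V w) `^ q)%R] < m%:E)%E.
Proof.
move=> q0 m0; rewrite !ltNge; apply: contra => mE.
rewrite /moment_norm -poweR_EFin; apply: gt0_ler_poweR => //.
- by rewrite invr_ge0 ltW.
- by rewrite in_itv/= lee_fin m0 leey.
- by rewrite in_itv/= leey andbT (le_trans _ mE)// lee_fin.
Qed.

(** * Expectation of the dominating function *)

Lemma measurable_cost_bound (R : realType) (d : nat) (q A e : R) :
  measurable_fun setT (@cost_bound R d q A e).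
Proof.
apply: measurable_funD.
  apply: measurable_funM => //; apply: measurableT_comp (measurable_powR q) _.
  exact: measurable_vnorm.
apply: measurable_funD; apply: measurable_funM => //.
  by apply: measurable_funX; exact: measurable_vnorm.
apply: measurable_sum => i; apply: measurable_funX.
exact: measurable_tnth_comp.
Qed.

Lemma cost_bound_ge0 (R : realType) (d : nat) (q A e : R) p :
  0 <= A -> 0 <= e -> 0 <= @cost_bound R d q A e p.
Proof.
move=> A0 e0; apply: addr_ge0.
  by rewrite mulr_ge0 ?powR_ge0// mulrn_wge0.
apply: addr_ge0; first by rewrite mulr_ge0 ?sqr_ge0// mulrn_wge0.
by rewrite mulr_ge0// sumr_ge0// => i _; exact: exprn_even_ge0.
Qed.

Lemma integral_cost_bound (R : realType) (d : nat) (disp : measure_display)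
    (T : measurableType disp) (P : probability T R) (q A e s : R)
    (U V : {RV P >-> d.-tuple R}) :
  0 <= A -> 0 <= e -> isotropic_gaussian P s U ->
  (\int[P]_w (cost_bound q A e (U w, V w))%:E =
   (A *+ d)%:E * 'E_P[fun w => (vnorm (V w) `^ q)%R] +
   ((e *+ d)%:E * 'E_P[fun w => (vnorm (V w) ^+ 2)%R] +
    e%:E * \sum_(i < d) \int[normal_prob 0 s]_x (x ^+ 4)%:E))%E.
Proof.
move=> A0 e0 gU; rewrite unlock.
have mV := measurable_vnorm (measurable_funPT V).
have mq : measurable_fun [set: T] (fun w => (vnorm (V w) `^ q)%:E).
  by apply/measurable_EFinP; exact: measurableT_comp (measurable_powR q) mV.
have m2 : measurable_fun [set: T] (fun w => (vnorm (V w) ^+ 2)%:E).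
  exact/measurable_EFinP/measurable_funX.
have m4 i : measurable_fun [set: T] (fun w => (tnth (U w) i ^+ 4)%:E).
  apply/measurable_EFinP/measurable_funX.
  by apply: measurable_tnth_comp.
have p4 (x : R) : (0 <= (x ^+ 4)%:E)%E by rewrite lee_fin exprn_even_ge0.
have mS : measurable_fun [set: T]
    (fun w => \sum_(i < d) (tnth (U w) i ^+ 4)%:E)%E.
  exact: emeasurable_sum.
have S0 w : (0 <= \sum_(i < d) (tnth (U w) i ^+ 4)%:E)%E by exact: sume_ge0.
transitivity (\int[P]_w ((A *+ d)%:E * (vnorm (V w) `^ q)%:E +
    ((e *+ d)%:E * (vnorm (V w) ^+ 2)%:E +
     e%:E * \sum_(i < d) (tnth (U w) i ^+ 4)%:E)))%E.
  by apply: eq_integral => w _; rewrite sumEFin -!EFinM -!EFinD.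
have Ad : (0 <= (A *+ d)%:E)%E by rewrite lee_fin mulrn_wge0.
have ed : (0 <= (e *+ d)%:E)%E by rewrite lee_fin mulrn_wge0.
have eE : (0 <= e%:E)%E by [].
have q0 w : (0 <= (vnorm (V w) `^ q)%:E)%E by rewrite lee_fin powR_ge0.
have s0 w : (0 <= (vnorm (V w) ^+ 2)%:E)%E by rewrite lee_fin sqr_ge0.
rewrite ge0_integralD//; last 4 first.
- by move=> w _; rewrite mule_ge0.
- exact: measurable_funeM.
- by move=> w _; rewrite adde_ge0// mule_ge0.
- by apply: emeasurable_funD; exact: measurable_funeM.
rewrite ge0_integralZl//; congr (_ + _)%E.
rewrite ge0_integralD//; last 4 first.
- by move=> w _; rewrite mule_ge0.
- exact: measurable_funeM.
- by move=> w _; rewrite mule_ge0.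
- exact: measurable_funeM.
rewrite !ge0_integralZl//; congr (_ + _ * _)%E.
rewrite ge0_integral_sum//.
have mX4 : measurable_fun [set: R] (fun x => (x ^+ 4)%:E).
  by apply/measurable_EFinP; exact: measurable_funX.
apply: eq_bigr => i _.
exact: (isotropic_gaussian_integral_coord i gU mX4 p4).
Qed.

Theorem lemma2p11 (R : realType) (q : R) (d : nat)
    (hq : 0 < q < 1) (hd : (0 < d)%N) :
  forall eps : R, 0 < eps ->
  exists delta : R, 0 < delta /\
  forall (disp : measure_display) (T : measurableType disp)
    (P : probability T R) (U V U' V' : {RV P >-> d.-tuple R}),
    centered P U -> centered P V ->
    ('E_P[fun w => (vnorm (U w) ^+ 2)%R] = 1)%E ->
    ('E_P[fun w => (vnorm (V w) ^+ 2)%R] = 1)%E ->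
    isotropic_gaussian P (Num.sqrt d%:R)^-1 U ->
    iid_copy P (fun w => (U w, V w)) (fun w => (U' w, V' w)) ->
    (moment_norm P q V < delta%:E)%E ->
    ('E_P[fun w => (vnorm (vsub (U w) (U' w)) * vnorm (vsub (V w) (V' w))
                   - vdot (vsub (U w) (U' w)) (vsub (V w) (V' w)))%R]
       < eps%:E)%E.
Proof.
move=> eps eps0; have /andP[q0 q1] := hq.
have d0 : 0 < d%:R :> R by rewrite ltr0n.
pose s : R := (Num.sqrt d%:R)^-1.
have sN0 : s != 0 by rewrite invr_eq0 gt_eqF// sqrtr_gt0.
have p4 : (0 <= \int[normal_prob 0 s]_x (x ^+ 4)%:E)%E.
  by apply: integral_ge0 => x _; rewrite lee_fin exprn_even_ge0.
have [M ME] : exists M, (\int[normal_prob 0 s]_x (x ^+ 4)%:E = M%:E)%E.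
  exists (fine (\int[normal_prob 0 s]_x (x ^+ 4)%:E)).
  by rewrite fineK// ge0_fin_numE// normal_fourth_moment_lty.
have M0 : 0 <= M by move: p4; rewrite ME lee_fin.
have den0 : 0 < 16 * d%:R ^+ 2 * (1 + M).
  by rewrite mulr_gt0 ?mulr_gt0 ?exprn_gt0// ltr_wpDr.
(* e and m make each of d e (1 + M) and d A m equal to eps / (16 d), while the
   domination multiplies their sum by 4 d, once for (U, V) and once for
   (U', V'). *)
pose e := eps / (16 * d%:R ^+ 2 * (1 + M)).
have e0 : 0 < e by rewrite divr_gt0.
have [A [A0 young]] := young_truncation (ltW q1) e0.
have den'0 : 0 < 16 * d%:R ^+ 2 * A by rewrite !mulr_gt0 ?exprn_gt0.
pose m := eps / (16 * d%:R ^+ 2 * A).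
have m0 : 0 < m by rewrite divr_gt0.
exists (m `^ q^-1); split; first exact: powR_gt0.
move=> disp T P U V U' V' _ _ _ V2 gU [UV _] Vq.
have {}Vq := moment_norm_lt q0 (ltW m0) Vq.
have mU := measurable_funPT U; have mU' := measurable_funPT U'.
have mV := measurable_funPT V; have mV' := measurable_funPT V'.
pose G w := cost_bound q A e (U w, V w).
pose G' w := cost_bound q A e (U' w, V' w).
have G0 w : (0 <= (G w)%:E)%E by rewrite lee_fin cost_bound_ge0 ?ltW.
have G'0 w : (0 <= (G' w)%:E)%E by rewrite lee_fin cost_bound_ge0 ?ltW.
have mUV : measurable_fun [set: T] (fun w => (U w, V w)).
  exact: measurable_fun_pair.
have mUV' : measurable_fun [set: T] (fun w => (U' w, V' w)).
  exact: measurable_fun_pair.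
have mG : measurable_fun [set: T] (EFin \o G).
  apply/measurable_EFinP.
  exact: measurableT_comp (measurable_cost_bound q A e) _.
have mG' : measurable_fun [set: T] (EFin \o G').
  apply/measurable_EFinP.
  exact: measurableT_comp (measurable_cost_bound q A e) _.
have GG' : (\int[P]_w (G' w)%:E = \int[P]_w (G w)%:E)%E.
  apply/esym/(same_law_integral (f := EFin \o cost_bound q A e) mUV mUV' UV).
    by apply/measurable_EFinP; exact: measurable_cost_bound.
  by move=> p; rewrite lee_fin cost_bound_ge0 ?ltW.
have IG : (\int[P]_w (G w)%:E < (eps / (8 * d%:R))%:E)%E.
  rewrite (integral_cost_bound _ _ (ltW A0) (ltW e0) gU) V2 ME mule1.
  rewrite sumEFin sumr_const card_ord.
  have -> : eps / (8 * d%:R) = (A *+ d) * m + (e *+ d + e * (M *+ d)).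
    rewrite /m /e -(mulr_natl A) -(mulr_natl _ d) -(mulr_natl M).
    by field; rewrite !gt_eqF// ltr_wpDr.
  rewrite EFinD lte_leD//.
  by rewrite EFinM lte_pmul2l// lte_fin -mulr_natl mulr_gt0.
have mdot := measurable_vdot (measurable_vsub mU mU') (measurable_vsub mV mV').
have mnorm : measurable_fun [set: T] (fun w =>
    vnorm (vsub (U w) (U' w)) * vnorm (vsub (V w) (V' w))).
  by apply: measurable_funM; apply: measurable_vnorm; exact: measurable_vsub.
have mI := measurable_funB mnorm mdot.
rewrite unlock; apply: (le_lt_trans (lee_abs _)).
apply: le_lt_trans.
  by apply: le_abse_integral => //; exact/measurable_EFinP.
have d4 : (0 <= (d%:R * 4)%:E :> \bar R)%E by rewrite lee_fin mulr_ge0.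
have -> : eps%:E = ((d%:R * 4)%:E *
    ((eps / (8 * d%:R))%:E + (eps / (8 * d%:R))%:E))%E.
  by rewrite -EFinD -EFinM; congr EFin; field; rewrite gt_eqF.
apply: (@le_lt_trans _ _
  (\int[P]_w ((d%:R * 4)%:E * ((G w)%:E + (G' w)%:E)))%E).
  apply: ge0_le_integral => //.
  - by apply: measurableT_comp => //; exact/measurable_EFinP.
  - by apply: measurable_funeM; exact: emeasurable_funD.
  - move=> w _; rewrite -EFinD -EFinM lee_fin.
    exact: normr_defect_le_cost_bound.
rewrite ge0_integralZl//; last 2 first.
- exact: emeasurable_funD.
- by move=> w _; rewrite adde_ge0.
rewrite ge0_integralD// GG' lte_pmul2l//; last by rewrite lte_fin mulr_gt0.
exact: lteD.
Qed.
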